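(* For every fixed integer $k\ge 1$, the propositional formulas $\mathrm{Kneser}^n_k$ ($n\ge 2k$) have polynomial size (in $n$) constant depth Frege proofs if the truncated Tucker tautologies $\mathrm{Ant}(\vec p)\rightarrow\mathrm{Comp}(\vec p)$ are given as additional hypotheses.
   Context: Notation: $[n]=\{1,\dots,n\}$, and $\binom{n}{k}$ is identified with the set of $k$-element subsets of $[n]$. Kneser formulas. Let $n \ge 2k > 1$ and $m = n-2k+1$. For $S \in \binom{n}{k}$ and $i \in [m]$ let $p_{S,i}$ be a propositional variable. The formula $\mathrm{Kneser}^n_k$ is $$\bigwedge_{S \in \binom{n}{k}} \bigvee_{i\in[m]} p_{S,i} \;\rightarrow\; \bigvee_{\substack{S,T\in\binom{n}{k}\\ S\cap T=\emptyset}} \bigvee_{i\in[m]} (p_{S,i}\wedge p_{T,i}).$$ Truncated Tucker tautologies. Let $$\mathcal{B}^n_k := \Bigl\{(A,B) : A,B \in \tbinom{n}{k}\cup\{\emptyset\},\ A\cap B=\emptyset,\ (A,B)\ne(\emptyset,\emptyset)\Bigr\}.$$ For $A\subseteq[n]$ with $|A|\ge k$, $A_{\le k}$ denotes the set of the $k$ least elements of $A$; also $\emptyset_{\le k}=\emptyset$. For $A_1,A_2\in\binom{n}{k}\cup\{\emptyset\}$, write $A_1\preceq A_2$ iff $(A_1\cup A_2)_{\le k}=A_2$. For $(A_1,B_1),(A_2,B_2)\in\mathcal{B}^n_k$, write $(A_1,B_1)\preceq(A_2,B_2)$ when $A_1\preceq A_2$, $B_1\preceq B_2$, and $A_i\cap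 B_j=\emptyset$ for all $i,j\in\{1,2\}$. The set $\{\pm 2k,\dots,\pm n\}$ consists of all integers $i$ with $2k\le|i|\le n$. For each $(A,B)\in\mathcal{B}^n_k$ and $i\in\{\pm 2k,\dots,\pm n\}$ let $p_{A,B,i}$ be a propositional variable. Then $\mathrm{Ant}(\vec p)$ is $$\bigwedge_{(A,B)\in\mathcal{B}^n_k}\ \bigvee_{i\in\{\pm2k,\dots,\pm n\}} (p_{A,B,i}\wedge p_{B,A,-i}),$$ and $\mathrm{Comp}(\vec p)$ is $$\bigvee_{\substack{(A_1,B_1),(A_2,B_2)\in\mathcal{B}^n_k,\\ (A_1,B_1)\preceq(A_2,B_2),\\ i\in\{\pm2k,\dots,\pm n\}}} (p_{A_1,B_1,i}\wedge p_{A_2,B_2,-i}).$$ The truncated Tucker tautology with parameters $n,k$ is $\mathrm{Ant}(\vec p)\rightarrow\mathrm{Comp}(\vec p)$. Proof systems. A Frege system is a sound and (implicationally) complete proof system for propositional logic with finitely many axiom schemes and inference rules; the size of a proof is the number of symbols in it. Constant depth means that all formulas in the proofs have depth (number of alternations of connectives, with unbounded fan-in $\wedge,\vee$) bounded by a constant independent of $n$. ''Given as additional hypotheses'' means that substitution instances of the truncated Tucker tautologies (formulas substituted for the variables $p_{A,B,i}$) may be used as axioms in the proof; these count towards the size and depth of the proof. ''Polynomial size'' means: for each fixed $k$, the size is bounded by a polynomial in $n$. *)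

(* Defs.v *)
(* Mathematical Components *)
From HB Require Import structures.
From mathcomp Require Import all_boot ssralg ssrint.

Set Implicit Arguments.
Unset Strict Implicit.
Unset Printing Implicit Defensive.

(** * Propositional formulas *)

Inductive form (V : Type) : Type :=
| Var of V
| Top
| Bot
| Neg of form V
| And of form V & form V
| Or of form V & form V
| Imp of form V & form V.

Arguments Top {V}.
Arguments Bot {V}.

Section EqForm.
Variable V : Type.

Fixpoint form_encode (phi : form V) : GenTree.tree V :=
  match phi with
  | Var v => GenTree.Leaf v
  | Top => GenTree.Node 0 [::]
  | Bot => GenTree.Node 1 [::]
  | Neg a => GenTree.Node 2 [:: form_encode a]
  | And a b => GenTree.Node 3 [:: form_encode a; form_encode b]
  | Or a b => GenTree.Node 4 [:: form_encode a; form_encode b]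
  | Imp a b => GenTree.Node 5 [:: form_encode a; form_encode b]
  end.

Fixpoint form_decode (t : GenTree.tree V) : option (form V) :=
  match t with
  | GenTree.Leaf v => Some (Var v)
  | GenTree.Node 0 [::] => Some Top
  | GenTree.Node 1 [::] => Some Bot
  | GenTree.Node 2 [:: a] => omap (@Neg V) (form_decode a)
  | GenTree.Node 3 [:: a; b] =>
      if (form_decode a, form_decode b) is (Some x, Some y)
      then Some (And x y) else None
  | GenTree.Node 4 [:: a; b] =>
      if (form_decode a, form_decode b) is (Some x, Some y)
      then Some (Or x y) else None
  | GenTree.Node 5 [:: a; b] =>
      if (form_decode a, form_decode b) is (Some x, Some y)
      then Some (Imp x y) else None
  | _ => None
  end.

Lemma form_encodeK : pcancel form_encode form_decode.
Proof.
by elim=> [v|||a IHa|a IHa b IHb|a IHa b IHb|a IHa b IHb] //=;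
  rewrite ?IHa ?IHb.
Qed.

End EqForm.

HB.instance Definition _ (V : eqType) :=
  Equality.copy (form V) (pcan_type (@form_encodeK V)).

Fixpoint eval (V : Type) (v : V -> bool) (phi : form V) : bool :=
  match phi with
  | Var x => v x
  | Top => true
  | Bot => false
  | Neg a => ~~ eval v a
  | And a b => eval v a && eval v b
  | Or a b => eval v a || eval v b
  | Imp a b => eval v a ==> eval v b
  end.

Fixpoint subst (V W : Type) (s : V -> form W) (phi : form V) : form W :=
  match phi with
  | Var x => s x
  | Top => Top
  | Bot => Bot
  | Neg a => Neg (subst s a)
  | And a b => And (subst s a) (subst s b)
  | Or a b => Or (subst s a) (subst s b)
  | Imp a b => Imp (subst s a) (subst s b)
  end.

(* A variable such as p_{S,i} counts as a single symbol. *)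
Fixpoint fsize (V : Type) (phi : form V) : nat :=
  match phi with
  | Var _ | Top | Bot => 1
  | Neg a => (fsize a).+1
  | And a b | Or a b | Imp a b => (fsize a + fsize b).+1
  end.

Definition is_And (V : Type) (phi : form V) : bool :=
  if phi is And _ _ then true else false.

Definition is_Or (V : Type) (phi : form V) : bool :=
  if phi is Or _ _ then true else false.

(* The depth of the tree obtained from phi by merging adjacent binary
   conjunctions (resp. disjunctions) into one node of unbounded fan-in.
   Every negation and every implication contributes a level of its own. *)
Fixpoint depth (V : Type) (phi : form V) : nat :=
  match phi with
  | Var _ | Top | Bot => 0
  | Neg a => (depth a).+1
  | And a b => (maxn (depth a - is_And a) (depth b - is_And b)).+1
  | Or a b => (maxn (depth a - is_Or a) (depth b - is_Or b)).+1
  | Imp a b => (maxn (depth a) (depth b)).+1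
  end.

(* Finite conjunctions and disjunctions, bracketed to the right.  No neutral
   element is added unless the list is empty. *)
Fixpoint bigand (V : Type) (s : seq (form V)) : form V :=
  match s with
  | [::] => Top
  | [:: a] => a
  | a :: s' => And a (bigand s')
  end.

Fixpoint bigor (V : Type) (s : seq (form V)) : form V :=
  match s with
  | [::] => Bot
  | [:: a] => a
  | a :: s' => Or a (bigor s')
  end.

(** * Frege systems *)

(* A schematic rule; its variables (of type nat) are the metavariables of the
   scheme, and an axiom scheme is a rule without premises. *)
Definition rule : eqType := (seq (form nat) * form nat)%type.

Definition premises (r : rule) : seq (form nat) := r.1.

Definition conclusion (r : rule) : form nat := r.2.

(* phi follows from earlier lines in pi by an instance of a rule of F. *)
Definition inference (V : eqType) (F : seq rule) (pi : seq (form V))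
    (phi : form V) : Prop :=
  exists r : rule, exists s : nat -> form V,
    [/\ r \in F,
        phi = subst s (conclusion r) &
        {in premises r, forall psi, subst s psi \in pi}].

(* Sequences of lines, each of which belongs to Hyp or is inferred from the
   preceding ones. *)
Inductive derivation (V : eqType) (F : seq rule) (Hyp : form V -> Prop) :
    seq (form V) -> Prop :=
| derivation_nil : derivation F Hyp [::]
| derivation_rcons (pi : seq (form V)) (phi : form V) :
    derivation F Hyp pi -> Hyp phi \/ inference F pi phi ->
    derivation F Hyp (rcons pi phi).

Definition is_proof (V : eqType) (F : seq rule) (Hyp : form V -> Prop)
    (pi : seq (form V)) (phi : form V) : Prop :=
  derivation F Hyp pi /\ exists pi' : seq (form V), pi = rcons pi' phi.

Definition proof_size (V : Type) (pi : seq (form V)) : nat :=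
  \sum_(phi <- pi) fsize phi.

Definition proof_depth_le (V : Type) (d : nat) (pi : seq (form V)) : bool :=
  all (fun phi => depth phi <= d) pi.

Definition derives (F : seq rule) (Gamma : seq (form nat)) (phi : form nat) :
    Prop :=
  exists pi : seq (form nat), is_proof F (fun psi => psi \in Gamma) pi phi.

Definition entails (Gamma : seq (form nat)) (phi : form nat) : Prop :=
  forall v : nat -> bool, {in Gamma, forall psi, eval v psi} -> eval v phi.

Definition sound (F : seq rule) : Prop :=
  forall Gamma phi, derives F Gamma phi -> entails Gamma phi.

Definition implicationally_complete (F : seq rule) : Prop :=
  forall Gamma phi, entails Gamma phi -> derives F Gamma phi.

Definition frege_system (F : seq rule) : Prop :=
  sound F /\ implicationally_complete F.

(** * Kneser formulas *)

(* The set {1, ..., n} is represented by 'I_n and the set of colors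
   {1, ..., n - 2k + 1} by 'I_(n - 2 * k).+1; only the case 2k <= n matters. *)

Definition ksubsets (n k : nat) : seq {set 'I_n} :=
  [seq X : {set 'I_n} <- enum {: {set 'I_n}} | #|X| == k].

(* The variable p_{S,i} is Var (S, i); only the sets S of size k occur. *)
Definition kvar (n k : nat) : eqType := ({set 'I_n} * 'I_(n - 2 * k).+1)%type.

Definition disjoint_pairs (n k : nat) : seq ({set 'I_n} * {set 'I_n}) :=
  [seq XY <- [seq (X, Y) | X <- ksubsets n k, Y <- ksubsets n k]
     | XY.1 :&: XY.2 == set0].

Definition kneser (n k : nat) : form (kvar n k) :=
  Imp
    (bigand [seq bigor [seq Var (X, i) | i <- enum 'I_(n - 2 * k).+1]
             | X <- ksubsets n k])
    (bigor [seq bigor [seq And (Var (XY.1, i)) (Var (XY.2, i))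
                       | i <- enum 'I_(n - 2 * k).+1]
             | XY <- disjoint_pairs n k]).

(** * Truncated Tucker tautologies *)

Definition ksubset_or_empty (n k : nat) (A : {set 'I_n}) : bool :=
  (#|A| == k) || (A == set0).

(* Pairs (A, B) making up the index set B^n_k *)
Definition tucker_pairs (n k : nat) : seq ({set 'I_n} * {set 'I_n}) :=
  [seq P <- enum {: {set 'I_n} * {set 'I_n}}
     | [&& ksubset_or_empty k P.1, ksubset_or_empty k P.2,
           P.1 :&: P.2 == set0 & P != (set0, set0)]].

(* The k least elements of A: those with fewer than k predecessors in A. *)
Definition least (n k : nat) (A : {set 'I_n}) : {set 'I_n} :=
  [set x in A | #|[set y in A | y < x]| < k].

Definition set_preceq (n k : nat) (A1 A2 : {set 'I_n}) : bool :=
  least k (A1 :|: A2) == A2.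

Definition pair_preceq (n k : nat) (P1 P2 : {set 'I_n} * {set 'I_n}) : bool :=
  [&& set_preceq k P1.1 P2.1, set_preceq k P1.2 P2.2,
      P1.1 :&: P1.2 == set0, P1.1 :&: P2.2 == set0,
      P2.1 :&: P1.2 == set0 & P2.1 :&: P2.2 == set0].

(* The integers i with 2k <= |i| <= n, for 0 < k *)
Definition labels (n k : nat) : seq int :=
  [seq Posz j | j <- index_iota (2 * k) n.+1] ++
  [seq (- Posz j)%R | j <- index_iota (2 * k) n.+1].

(* The variable p_{A,B,i} is Var (A, B, i). *)
Definition tvar (n : nat) : eqType := ({set 'I_n} * {set 'I_n} * int)%type.

Definition tucker_ant (n k : nat) : form (tvar n) :=
  bigand [seq bigor [seq And (Var (P.1, P.2, i)) (Var (P.2, P.1, (- i)%R))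
                    | i <- labels n k]
          | P <- tucker_pairs n k].

Definition comparable_pairs (n k : nat) :
    seq (({set 'I_n} * {set 'I_n}) * ({set 'I_n} * {set 'I_n})) :=
  [seq PQ <- [seq (P, Q) | P <- tucker_pairs n k, Q <- tucker_pairs n k]
     | pair_preceq k PQ.1 PQ.2].

Definition tucker_comp (n k : nat) : form (tvar n) :=
  bigor [seq And (Var (PQ.1.1, PQ.1.2, i)) (Var (PQ.2.1, PQ.2.2, (- i)%R))
          | PQ <- comparable_pairs n k, i <- labels n k].

Definition truncated_tucker (n k : nat) : form (tvar n) :=
  Imp (tucker_ant n k) (tucker_comp n k).

Definition tucker_instance (V : Type) (n k : nat) (phi : form V) : Prop :=
  exists s : tvar n -> form V, phi = subst s (truncated_tucker n k).

(* Main.v *)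
Require Import Defs.
From mathcomp Require Import all_boot ssralg ssrint zify.

Set Implicit Arguments.
Unset Strict Implicit.
Unset Printing Implicit Defensive.

(** A vertex coloring of the Kneser graph is itself a labelling to which the
    truncated Tucker tautology applies.  The colors are matched with the
    positive labels 2k, ..., n, and the variable p_{A,B,j} is replaced by the
    variable saying that A has the color of label j, while p_{A,B,-j} is
    replaced by the one saying that B has it (the constant false when the set
    in question is empty).  Swapping A and B amounts to negating the label, so
    both conjuncts in Ant become the same variable, and Ant follows from the
    hypothesis that every k-set has a color.  An edge with opposite labels j
    and -j becomes a pair of k-sets, one from each pair, of the same color; the
    comparability of the two pairs makes these sets disjoint, so Comp yields
    the conclusion of the Kneser formula.  A set may have several colors: no
    choice of a color is ever made.

    To write this argument as a short proof in an arbitrary Frege system F, ten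
    elementary rules are fixed.  By implicational completeness each of them is
    derivable in F, so one constant K bounds the length and the line sizes of
    these ten derivations ([simulates_all]).  Substituting formulas of size at
    most m and depth at most d then costs at most K lines, each of size at most
    K * m and depth at most K + d ([provable_rule]).  Consequently it is enough
    to keep count of lines: [provable N s] says that N such lines suffice for
    deriving all formulas of s.  The rules only ever conclude implications
    between subformulas of the four formulas in play, which have polynomial
    size and depth at most 3; keeping the premise in front of every conclusion
    takes the place of a deduction theorem.  The rules for long conjunctions
    and disjunctions cost a number of lines proportional to the number of
    members, and all lists involved have polynomial length for fixed k
    ([list_sizes]). *)

(** * Substitution, size and depth *)

Lemma subst_subst (U V W : Type) (s : V -> form W) (t : U -> form V) phi :
  subst s (subst t phi) = subst (fun x => subst s (t x)) phi.
Proof. by elim: phi => //= [a ->|a -> b ->|a -> b ->|a -> b ->]. Qed.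

Lemma subst_bigand (V W : Type) (s : V -> form W) l :
  subst s (bigand l) = bigand [seq subst s phi | phi <- l].
Proof. by elim: l => // a [|b l] //= ->. Qed.

Lemma subst_bigor (V W : Type) (s : V -> form W) l :
  subst s (bigor l) = bigor [seq subst s phi | phi <- l].
Proof. by elim: l => // a [|b l] //= ->. Qed.

Lemma fsize_subst (V W : Type) (s : V -> form W) m phi : 0 < m ->
  (forall x, fsize (s x) <= m) -> fsize (subst s phi) <= fsize phi * m.
Proof.
move=> m_gt0 hs.
by elim: phi => /= [x|||a|a ha b hb|a ha b hb|a ha b hb];
  [have := hs x|..]; nia.
Qed.

(** The size of phi bounds its height, hence the number of levels that phi can
    put on top of the formulas substituted. *)
Lemma depth_subst (V W : Type) (s : V -> form W) d phi :
  (forall x, depth (s x) <= d) -> depth (subst s phi) <= fsize phi + d.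
Proof.
move=> hs.
by elim: phi => /= [x|||a|a ha b hb|a ha b hb|a ha b hb];
  [have := hs x|..]; lia.
Qed.

Lemma fsize_bigand (V : Type) f (l : seq (form V)) :
  all (fun phi => fsize phi <= f) l -> fsize (bigand l) <= size l * f.+1 + 1.
Proof.
elim: l => [|a [|b l] IH] //=; first by rewrite andbT; lia.
by case/andP=> ha hl; have := IH hl; rewrite /=; lia.
Qed.

Lemma fsize_bigor (V : Type) f (l : seq (form V)) :
  all (fun phi => fsize phi <= f) l -> fsize (bigor l) <= size l * f.+1 + 1.
Proof.
elim: l => [|a [|b l] IH] //=; first by rewrite andbT; lia.
by case/andP=> ha hl; have := IH hl; rewrite /=; lia.
Qed.

(** The induction needs the depth discounted by merging: a conjunction nested
    to the right in another one adds no level. *)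
Lemma depth_bigand (V : Type) d (l : seq (form V)) :
  all (fun phi => depth phi <= d) l -> depth (bigand l) <= d.+1.
Proof.
move=> hl; suff: depth (bigand l) - is_And (bigand l) <= d.
  by case: (is_And _) => /=; lia.
elim: l hl => [|a [|b l] IH] //=; first by rewrite andbT; lia.
by case/andP=> ha hl; have := IH hl; rewrite /=; lia.
Qed.

Lemma depth_bigor (V : Type) d (l : seq (form V)) :
  all (fun phi => depth phi <= d) l -> depth (bigor l) <= d.+1.
Proof.
move=> hl; suff: depth (bigor l) - is_Or (bigor l) <= d.
  by case: (is_Or _) => /=; lia.
elim: l hl => [|a [|b l] IH] //=; first by rewrite andbT; lia.
by case/andP=> ha hl; have := IH hl; rewrite /=; lia.
Qed.

(** * Composing derivations *)

Section Derivations.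
Variables (V : eqType) (F : seq rule) (Hyp : form V -> Prop).

Lemma sub_inference (pi rho : seq (form V)) phi :
  {subset pi <= rho} -> inference F pi phi -> inference F rho phi.
Proof.
by move=> sub [r [s [rF -> hr]]]; exists r, s; split=> // psi /hr /sub.
Qed.

Lemma derivation_cat pi rho :
  derivation F Hyp pi -> derivation F Hyp rho -> derivation F Hyp (pi ++ rho).
Proof.
move=> dpi; elim=> [|rho' phi _ IH step]; first by rewrite cats0.
rewrite -rcons_cat; apply: derivation_rcons => //.
case: step => [|inf]; [by left|right].
by apply: sub_inference inf => psi h; rewrite mem_cat h orbT.
Qed.

Lemma derivation_prefix pi rho :
  derivation F Hyp (pi ++ rho) -> derivation F Hyp pi.
Proof.
elim/last_ind: rho => [|rho phi IH]; first by rewrite cats0.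
rewrite -rcons_cat => h; apply: IH; move: h.
move E: (rcons _ _) => tau h; case: h E => [|tau' psi d _].
  by case: (pi ++ rho).
by move/rcons_inj=> [->].
Qed.

(** The formulas of G in pi are the only lines that do not come from a rule, and
    their instances are already lines of rho.  Since repeating a line is not an
    inference, these lines are skipped rather than copied, which is why tau is
    not simply the image of pi. *)
Lemma derivation_subst (G : seq (form nat)) (s : nat -> form V) rho pi :
  derivation F (fun psi => psi \in G) pi ->
  derivation F Hyp rho ->
  {in G, forall psi, subst s psi \in rho} ->
  exists tau, [/\ derivation F Hyp (rho ++ tau), size tau <= size pi,
    {subset tau <= map (subst s) pi} &
    {subset map (subst s) pi <= rho ++ tau}].
Proof.
move=> dpi drho hG; elim: dpi => [|pi' phi _ [tau [dtau ltau tau_pi pi_tau]]].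
  by exists [::]; rewrite cats0.
case=> [/hG phi_rho | [r [t [rF -> hr]]]].
  exists tau; split=> //.
  - by rewrite size_rcons; lia.
  - by move=> x /tau_pi; rewrite map_rcons mem_rcons inE orbC => ->.
  move=> x; rewrite map_rcons mem_rcons inE => /predU1P[->|/pi_tau //].
  by rewrite mem_cat phi_rho.
exists (rcons tau (subst s (subst t (conclusion r)))); split.
- rewrite -rcons_cat; apply: derivation_rcons => //; right.
  exists r, (fun x => subst s (t x)); split=> //; first exact: subst_subst.
  by move=> psi /hr h; apply: pi_tau; rewrite -subst_subst map_f.
- by rewrite !size_rcons.
- move=> x; rewrite map_rcons !mem_rcons !inE => /predU1P[->|/tau_pi ->].
    by rewrite eqxx.
  by rewrite orbT.
move=> x; rewrite map_rcons -rcons_cat !mem_rcons !inE.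
by case/predU1P=> [->|/pi_tau ->]; rewrite ?eqxx ?orbT.
Qed.

End Derivations.

(** * Elementary rules and their simulation *)

Definition simulates (F : seq rule) (K : nat) (r : rule) : Prop :=
  exists pi : seq (form nat),
    [/\ derivation F (fun psi => psi \in premises r) pi,
        conclusion r \in pi, size pi <= K &
        all (fun psi => fsize psi <= K) pi].

Lemma simulates_mono F K K' r : K <= K' -> simulates F K r -> simulates F K' r.
Proof.
move=> le [pi [dpi rpi szpi fpi]]; exists pi; split=> //; first by lia.
by apply: sub_all fpi => psi; lia.
Qed.

(** Completeness yields a derivation for each rule, and finitely many costs have
    a common bound, which depends on the schemes only and not on the formulas
    substituted in them. *)
Lemma simulates_all F (R : seq rule) : implicationally_complete F ->
  {in R, forall r, entails (premises r) (conclusion r)} ->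
  exists K, {in R, forall r, simulates F K r}.
Proof.
move=> hF; elim: R => [_|r R IH hR]; first by exists 0.
have [|K hK] := IH; first by move=> q qR; apply: hR; rewrite inE qR orbT.
have [pi [dpi [pi' def_pi]]] := hF _ _ (hR r (mem_head _ _)).
pose K' := K + size pi + \sum_(psi <- pi) fsize psi.
exists K' => q; rewrite inE => /predU1P[->|/hK]; last first.
  by apply: simulates_mono; rewrite /K'; lia.
exists pi; split=> //; first by rewrite def_pi mem_rcons mem_head.
  by rewrite /K'; lia.
apply/allP=> psi psi_pi.
by rewrite /K' (big_rem psi) //= addnCA leq_addr.
Qed.

Local Notation vx := (Var 0).
Local Notation va := (Var 1).
Local Notation vb := (Var 2).

Definition imp_refl : rule := ([::], Imp vx vx).
Definition imp_trans : rule := ([:: Imp vx va; Imp va vb], Imp vx vb).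
Definition bot_elim : rule := ([::], Imp Bot vx).
Definition top_intro : rule := ([::], Imp vx Top).
Definition or_introl : rule := ([::], Imp vx (Or vx va)).
Definition or_intror : rule := ([:: Imp vx vb], Imp vx (Or va vb)).
Definition or_elim : rule := ([:: Imp va vx; Imp vb vx], Imp (Or va vb) vx).
Definition and_intro : rule := ([:: Imp vx va; Imp vx vb], Imp vx (And va vb)).
Definition and_eliml : rule := ([:: Imp vx (And va vb)], Imp vx va).
Definition and_elimr : rule := ([:: Imp vx (And va vb)], Imp vx vb).

Definition basic_rules : seq rule :=
  [:: imp_refl; imp_trans; bot_elim; top_intro; or_introl; or_intror; or_elim;
      and_intro; and_eliml; and_elimr].

Lemma basic_rules_entail :
  {in basic_rules, forall r, entails (premises r) (conclusion r)}.
Proof.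
rewrite /basic_rules => r; rewrite !inE.
do 9![case/predU1P=> [->|];
  first by move=> v /allP /=; case: (v 0); case: (v 1); case: (v 2)].
by move/eqP=> -> v /allP /=; case: (v 0); case: (v 1); case: (v 2).
Qed.

(** * Counting lines *)

Section ShortProofs.
Variables (V : eqType) (F : seq rule) (Hyp : form V -> Prop).
Variables (K m d : nat).
Hypothesis m_gt0 : 0 < m.
Hypothesis simF : {in basic_rules, forall r, simulates F K r}.

Definition small (phi : form V) : bool := (fsize phi <= m) && (depth phi <= d).

Definition short_line (phi : form V) : bool :=
  (fsize phi <= K * m) && (depth phi <= K + d).

(** The lines of the derivation need not end with s: a formula that is derived
    along the way counts, so that derivations can be concatenated freely. *)
Definition provable (N : nat) (s : seq (form V)) : Prop :=
  exists pi : seq (form V),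
    [/\ derivation F Hyp pi, {subset s <= pi}, size pi <= N &
        all short_line pi].

Lemma provable0 : provable 0 [::].
Proof. by exists [::]; split=> //; apply: derivation_nil. Qed.

Lemma provable_cat N1 N2 s1 s2 :
  provable N1 s1 -> provable N2 s2 -> provable (N1 + N2) (s1 ++ s2).
Proof.
move=> [p1 [d1 h1 z1 l1]] [p2 [d2 h2 z2 l2]]; exists (p1 ++ p2); split.
- exact: derivation_cat.
- by move=> psi; rewrite !mem_cat => /orP[/h1|/h2] ->; rewrite ?orbT.
- by rewrite size_cat leq_add.
- by rewrite all_cat l1.
Qed.

Lemma provable_le N N' s : N <= N' -> provable N s -> provable N' s.
Proof.
by move=> le [pi [? ? ? ?]]; exists pi; split=> //; apply: leq_trans le.
Qed.

Lemma provable_hyp phi : Hyp phi -> short_line phi -> provable 1 [:: phi].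
Proof.
move=> hphi sphi; exists [:: phi]; split=> //=; last by rewrite sphi.
by apply: (@derivation_rcons _ _ _ [::] phi); [apply: derivation_nil|left].
Qed.

(** Metavariables outside the rule may occur in its derivation in F; sending
    every index beyond l to Top keeps all substituted formulas small. *)
Lemma provable_rule r l N : r \in basic_rules -> all small l ->
  provable N (map (subst (nth Top l)) (premises r)) ->
  provable (N + K) [:: subst (nth Top l) (conclusion r)].
Proof.
move=> rR /allP l_small [rho [drho hrho lrho srho]].
have [pi [dpi cpi szpi fpi]] := simF rR.
have s_small i : small (nth Top l i).
  case: (ltnP i (size l)) => [lt_il|le_li]; last first.
    by rewrite nth_default // /small m_gt0.
  by apply: l_small; rewrite mem_nth.
have [|tau [dtau ltau tau_pi pi_tau]] :=
  derivation_subst (s := nth Top l) dpi drho.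
  by move=> psi hpsi; apply: hrho; rewrite map_f.
exists (rho ++ tau); split=> //.
- by move=> psi; rewrite inE => /eqP->; apply: pi_tau; rewrite map_f.
- by rewrite size_cat leq_add ?(leq_trans ltau).
rewrite all_cat srho /=; apply/allP=> psi /tau_pi /mapP[chi chi_pi ->].
have fchi := allP fpi _ chi_pi; apply/andP; split.
  have := @fsize_subst _ _ (nth Top l) m chi m_gt0
    (fun i => proj1 (andP (s_small i))).
  by nia.
have := @depth_subst _ _ (nth Top l) d chi (fun i => proj2 (andP (s_small i))).
by lia.
Qed.

Lemma provable_refl phi : small phi -> provable K [:: Imp phi phi].
Proof.
move=> h; apply: (@provable_rule imp_refl [:: phi] 0) provable0 => //=.
by rewrite h.
Qed.

Lemma provable_trans phi psi chi N1 N2 : small phi -> small psi -> small chi ->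
  provable N1 [:: Imp phi psi] -> provable N2 [:: Imp psi chi] ->
  provable (N1 + N2 + K) [:: Imp phi chi].
Proof.
move=> h1 h2 h3 p1 p2.
apply: (@provable_rule imp_trans [:: phi; psi; chi]) (provable_cat p1 p2) => //=.
by rewrite h1 h2 h3.
Qed.

Lemma provable_bot phi : small phi -> provable K [:: Imp Bot phi].
Proof.
move=> h; apply: (@provable_rule bot_elim [:: phi] 0) provable0 => //=.
by rewrite h.
Qed.

Lemma provable_top phi : small phi -> provable K [:: Imp phi Top].
Proof.
move=> h; apply: (@provable_rule top_intro [:: phi] 0) provable0 => //=.
by rewrite h.
Qed.

Lemma provable_orl phi psi : small phi -> small psi ->
  provable K [:: Imp phi (Or phi psi)].
Proof.
move=> h1 h2; apply: (@provable_rule or_introl [:: phi; psi] 0) provable0 => //=.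
by rewrite h1 h2.
Qed.

Lemma provable_orr chi phi psi N : small chi -> small phi -> small psi ->
  provable N [:: Imp chi psi] -> provable (N + K) [:: Imp chi (Or phi psi)].
Proof.
move=> h1 h2 h3; apply: (@provable_rule or_intror [:: chi; phi; psi]) => //=.
by rewrite h1 h2 h3.
Qed.

Lemma provable_or_elim chi phi psi N1 N2 : small chi -> small phi -> small psi ->
  provable N1 [:: Imp phi chi] -> provable N2 [:: Imp psi chi] ->
  provable (N1 + N2 + K) [:: Imp (Or phi psi) chi].
Proof.
move=> h1 h2 h3 p1 p2.
apply: (@provable_rule or_elim [:: chi; phi; psi]) (provable_cat p1 p2) => //=.
by rewrite h1 h2 h3.
Qed.

Lemma provable_and_intro chi phi psi N1 N2 :
  small chi -> small phi -> small psi ->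
  provable N1 [:: Imp chi phi] -> provable N2 [:: Imp chi psi] ->
  provable (N1 + N2 + K) [:: Imp chi (And phi psi)].
Proof.
move=> h1 h2 h3 p1 p2.
apply: (@provable_rule and_intro [:: chi; phi; psi]) (provable_cat p1 p2) => //=.
by rewrite h1 h2 h3.
Qed.

Lemma provable_and_eliml chi phi psi N : small chi -> small phi -> small psi ->
  provable N [:: Imp chi (And phi psi)] -> provable (N + K) [:: Imp chi phi].
Proof.
move=> h1 h2 h3; apply: (@provable_rule and_eliml [:: chi; phi; psi]) => //=.
by rewrite h1 h2 h3.
Qed.

Lemma provable_and_elimr chi phi psi N : small chi -> small phi -> small psi ->
  provable N [:: Imp chi (And phi psi)] -> provable (N + K) [:: Imp chi psi].
Proof.
move=> h1 h2 h3; apply: (@provable_rule and_elimr [:: chi; phi; psi]) => //=.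
by rewrite h1 h2 h3.
Qed.

Lemma small_Var v : small (Var v).
Proof. by rewrite /small m_gt0. Qed.

(** Merging lowers the depth of a conjunct by at most one, and the conjunction
    adds this level back; the same holds for disjunctions. *)
Lemma small_And phi psi : small (And phi psi) -> small phi /\ small psi.
Proof.
clear m_gt0 simF; move=> /andP[/= h1 h2].
have := leq_b1 (is_And phi); have := leq_b1 (is_And psi).
by split; apply/andP; split; lia.
Qed.

Lemma small_Or phi psi : small (Or phi psi) -> small phi /\ small psi.
Proof.
clear m_gt0 simF; move=> /andP[/= h1 h2].
have := leq_b1 (is_Or phi); have := leq_b1 (is_Or psi).
by split; apply/andP; split; lia.
Qed.

Lemma small_bigand phi s :
  small (bigand (phi :: s)) -> small phi /\ small (bigand s).
Proof.
by case: s => [|psi s] /= h; [rewrite h /small m_gt0 | apply: small_And].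
Qed.

Lemma small_bigor phi s :
  small (bigor (phi :: s)) -> small phi /\ small (bigor s).
Proof.
by case: s => [|psi s] /= h; [rewrite h /small m_gt0 | apply: small_Or].
Qed.

Lemma small_bigand_mem phi s : small (bigand s) -> phi \in s -> small phi.
Proof.
elim: s => // psi s IH /small_bigand[h1 h2].
by rewrite inE => /predU1P[->|/(IH h2)].
Qed.

Lemma small_bigor_mem phi s : small (bigor s) -> phi \in s -> small phi.
Proof.
elim: s => // psi s IH /small_bigor[h1 h2].
by rewrite inE => /predU1P[->|/(IH h2)].
Qed.

(** * Long conjunctions and disjunctions *)

Lemma provable_bigand_elim chi phi s N :
  small chi -> small (bigand s) -> phi \in s ->
  provable N [:: Imp chi (bigand s)] ->
  provable (N + size s * K) [:: Imp chi phi].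
Proof.
move=> hchi; elim: s N => // psi [|psi' s] IH N hs.
  by rewrite inE => /eqP->; apply: provable_le; lia.
have [hpsi hs'] := small_bigand hs.
rewrite inE => /predU1P[->|phi_s] p.
  apply: provable_le (provable_and_eliml hchi hpsi hs' p).
  by rewrite /=; lia.
apply: provable_le (IH _ hs' phi_s (provable_and_elimr hchi hpsi hs' p)).
by rewrite /=; lia.
Qed.

Lemma provable_bigand_intro chi s N : small chi -> small (bigand s) ->
  {in s, forall phi, provable N [:: Imp chi phi]} ->
  provable (size s * (N + K) + K) [:: Imp chi (bigand s)].
Proof.
move=> hchi; elim: s => [|phi [|psi s] IH] hs p.
- by apply: provable_le (provable_top hchi); lia.
- by apply: provable_le (p phi (mem_head _ _)); rewrite /=; lia.
have [hphi hs'] := small_bigand hs.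
have p' : {in psi :: s, forall phi, provable N [:: Imp chi phi]}.
  by move=> phi' h; apply: p; rewrite inE h orbT.
apply: provable_le
  (provable_and_intro hchi hphi hs' (p phi (mem_head _ _)) (IH hs' p')).
by rewrite /=; lia.
Qed.

Lemma provable_bigor_intro phi s : small (bigor s) -> phi \in s ->
  provable (size s * K) [:: Imp phi (bigor s)].
Proof.
elim: s => // psi [|psi' s] IH hs.
  by rewrite inE => /eqP->; apply: provable_le (provable_refl hs); rewrite /=; lia.
have [hpsi hs'] := small_bigor hs.
rewrite inE => /predU1P[->|phi_s].
  by apply: provable_le (provable_orl hpsi hs'); rewrite /=; lia.
have hphi := small_bigor_mem hs' phi_s.
apply: provable_le (provable_orr hphi hpsi hs' (IH hs' phi_s)).
by rewrite /=; lia.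
Qed.

Lemma provable_bigor_elim chi s N : small chi -> small (bigor s) ->
  {in s, forall phi, provable N [:: Imp phi chi]} ->
  provable (size s * (N + K) + K) [:: Imp (bigor s) chi].
Proof.
move=> hchi; elim: s => [|phi [|psi s] IH] hs p.
- by apply: provable_le (provable_bot hchi); lia.
- by apply: provable_le (p phi (mem_head _ _)); rewrite /=; lia.
have [hphi hs'] := small_bigor hs.
have p' : {in psi :: s, forall phi, provable N [:: Imp phi chi]}.
  by move=> phi' h; apply: p; rewrite inE h orbT.
apply: provable_le
  (provable_or_elim hchi hphi hs' (p phi (mem_head _ _)) (IH hs' p')).
by rewrite /=; lia.
Qed.

Lemma provable_bigor_sub s t N : small (bigor s) -> small (bigor t) ->
  {in s, forall phi,
    exists psi, psi \in t /\ provable N [:: Imp phi psi]} ->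
  provable (size s * (N + size t * K + K + K) + K) [:: Imp (bigor s) (bigor t)].
Proof.
move=> hs ht p; apply: provable_bigor_elim => // phi phi_s.
have [psi [psi_t q]] := p _ phi_s.
apply: (provable_trans _ _ ht q (provable_bigor_intro ht psi_t)).
  exact: small_bigor_mem phi_s.
exact: small_bigor_mem psi_t.
Qed.

(** Cutting the derivation right after phi makes phi its last line. *)
Lemma provable_is_proof N phi : provable N [:: phi] ->
  exists pi, [/\ is_proof F Hyp pi phi, proof_size pi <= N * (K * m) &
                 proof_depth_le (K + d) pi].
Proof.
move=> [pi [dpi sub le_pi lpi]].
have phi_pi : phi \in pi by apply: sub; rewrite mem_head.
have [p1 [p2 def_pi]] : exists p1 p2, pi = rcons p1 phi ++ p2.
  by case/path.splitP: phi_pi => p1 p2; exists p1, p2.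
move: dpi le_pi lpi; rewrite def_pi => /derivation_prefix dp1.
rewrite size_cat all_cat => le_pi /andP[/allP lp1 _].
exists (rcons p1 phi); split.
- by split=> //; exists p1.
- apply: (@leq_trans (\sum_(psi <- rcons p1 phi) K * m)).
    rewrite /proof_size !big_seq; apply: leq_sum => psi /lp1.
    by case/andP.
  rewrite big_const_seq count_predT iter_addn_0 [leqLHS]mulnC.
  by rewrite leq_mul2r (leq_trans (leq_addr _ _) le_pi) orbT.
by apply/allP=> psi /lp1 /andP[].
Qed.

End ShortProofs.

(** * The coloring as a Tucker labelling *)

Section KneserFromTucker.
Variables n k : nat.
Hypotheses (k_gt0 : 0 < k) (le_2k_n : 2 * k <= n).

(** The label j stands for the color j - 2k. *)
Definition color_atom (X : {set 'I_n}) (j : nat) : form (kvar n k) :=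
  if X == set0 then Bot else Var (X, inord (j - 2 * k)).

(** The substitution for the variables p_{A,B,i}: a positive label speaks of A,
    a negative one of B.  The integer [Negz j] is -(j+1). *)
Definition tucker_coloring (p : tvar n) : form (kvar n k) :=
  match p.2 with
  | Posz j => color_atom p.1.1 j
  | Negz j => color_atom p.1.2 j.+1
  end.

Lemma tucker_coloring_opp A B j : 0 < j ->
  tucker_coloring (A, B, - Posz j)%R = color_atom B j.
Proof. by case: j. Qed.

Definition color_disj (X : {set 'I_n}) : form (kvar n k) :=
  bigor [seq Var (X, i) | i <- enum 'I_(n - 2 * k).+1].

Definition colored_all : form (kvar n k) :=
  bigand [seq color_disj X | X <- ksubsets n k].

Definition clash_disj (XY : {set 'I_n} * {set 'I_n}) : form (kvar n k) :=
  bigor [seq And (Var (XY.1, i)) (Var (XY.2, i)) | i <- enum 'I_(n - 2 * k).+1].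

Definition clash : form (kvar n k) :=
  bigor [seq clash_disj XY | XY <- disjoint_pairs n k].

Lemma kneserE : kneser n k = Imp colored_all clash.
Proof. by []. Qed.

Definition antipodal_disj (P : {set 'I_n} * {set 'I_n}) : form (kvar n k) :=
  bigor [seq And (tucker_coloring (P.1, P.2, i))
                 (tucker_coloring (P.2, P.1, - i)%R) | i <- labels n k].

Definition antipodal_all : form (kvar n k) :=
  bigand [seq antipodal_disj P | P <- tucker_pairs n k].

Definition complementary_edge : form (kvar n k) :=
  bigor [seq And (tucker_coloring (PQ.1.1, PQ.1.2, i))
                 (tucker_coloring (PQ.2.1, PQ.2.2, - i)%R)
        | PQ <- comparable_pairs n k, i <- labels n k].

Lemma subst_truncated_tucker :
  subst tucker_coloring (truncated_tucker n k) =
  Imp antipodal_all complementary_edge.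
Proof.
rewrite /= subst_bigand subst_bigor map_allpairs -map_comp.
congr (Imp (bigand _) _).
by apply: eq_map => P /=; rewrite subst_bigor -map_comp.
Qed.

Lemma mem_ksubsets X : (X \in ksubsets n k) = (#|X| == k).
Proof. by rewrite mem_filter mem_enum andbT. Qed.

Lemma mem_tucker_pairs P : (P \in tucker_pairs n k) =
  [&& ksubset_or_empty k P.1, ksubset_or_empty k P.2,
      P.1 :&: P.2 == set0 & P != (set0, set0)].
Proof. by rewrite mem_filter mem_enum andbT. Qed.

Lemma mem_labels i : i \in labels n k ->
  exists2 j, 2 * k <= j <= n & i = Posz j \/ i = (- Posz j)%R.
Proof.
by rewrite mem_cat => /orP[] /mapP[j]; rewrite mem_index_iota ltnS => hj ->;
  exists j => //; [left|right].
Qed.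

Lemma labels_color (i : 'I_(n - 2 * k).+1) :
  Posz (2 * k + i) \in labels n k /\ (- Posz (2 * k + i))%R \in labels n k.
Proof.
have hi : 2 * k + i \in index_iota (2 * k) n.+1.
  by rewrite mem_index_iota; have := ltn_ord i; lia.
by rewrite !mem_cat (map_f Posz hi) (map_f (fun j => - Posz j)%R hi) orbT.
Qed.

Lemma color_atom_label X (i : 'I_(n - 2 * k).+1) :
  X != set0 -> color_atom X (2 * k + i) = Var (X, i).
Proof. by move=> /negbTE X0; rewrite /color_atom X0 addKn inord_val. Qed.

(** * The two implications *)

Section Steps.
Variables (F : seq rule) (Hyp : form (kvar n k) -> Prop).
Variables (K m d : nat).
Hypothesis m_gt0 : 0 < m.
Hypothesis simF : {in basic_rules, forall r, simulates F K r}.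

Local Notation small := (small m d).
Local Notation provable := (provable F Hyp K m d).
Local Notation q := (n - 2 * k).+1.

(** The set X is the first nonempty component of P.  If X has color i, then the
    label 2k + i works when X is the first component, and its opposite when X
    is the second one; in both cases the two conjuncts are Var (X, i). *)
Lemma provable_antipodal P :
  P \in tucker_pairs n k -> small (antipodal_disj P) ->
  exists X, [/\ X \in ksubsets n k &
    small (color_disj X) ->
    provable (q * (3 * K + size (labels n k) * K + K + K) + K)
      [:: Imp (color_disj X) (antipodal_disj P)]].
Proof.
rewrite mem_tucker_pairs => /and4P[kA kB _ P_neq0] hP.
pose X := if P.1 == set0 then P.2 else P.1.
have X_neq0 : X != set0.
  rewrite /X; case: ifPn => // /eqP A0; apply: contraNneq P_neq0 => B0.
  by case: (P) A0 B0 => A B /= -> ->.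
exists X; split.
  have: ksubset_or_empty k X by rewrite /X; case: ifP.
  by rewrite mem_ksubsets /ksubset_or_empty (negbTE X_neq0) orbF.
move=> hX.
have -> : q = size [seq Var (X, i) | i <- enum 'I_q].
  by rewrite size_map size_enum_ord.
have -> : size (labels n k) = size [seq And (tucker_coloring (P.1, P.2, i))
   (tucker_coloring (P.2, P.1, - i)%R) | i <- labels n k].
  by rewrite size_map.
apply: provable_bigor_sub => // _ /mapP[i _ ->].
have [pos neg] := labels_color i.
exists (And (Var (X, i)) (Var (X, i))); split.
  have j_gt0 : 0 < 2 * k + i by rewrite addn_gt0 muln_gt0 k_gt0.
  apply/mapP; move: (color_atom_label i X_neq0).
  rewrite /X; case: ifPn => _ colX.
    exists (- Posz (2 * k + i))%R => //.
    by rewrite GRing.opprK tucker_coloring_opp // /tucker_coloring /= colX.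
  exists (Posz (2 * k + i)) => //.
  by rewrite tucker_coloring_opp // /tucker_coloring /= colX.
have hXi := small_Var d m_gt0 (X, i).
apply: provable_le (provable_and_intro m_gt0 simF hXi hXi hXi
  (provable_refl _ m_gt0 simF hXi) (provable_refl _ m_gt0 simF hXi)).
by rewrite !mulSn mul0n addn0 addnA.
Qed.

(** If X or Y is empty, one conjunct is Bot; otherwise the conjunction is
    literally one of the disjuncts of clash. *)
Lemma provable_clash X Y j :
  ksubset_or_empty k X -> ksubset_or_empty k Y -> X :&: Y == set0 ->
  small (And (color_atom X j) (color_atom Y j)) -> small clash ->
  provable ((q + size (disjoint_pairs n k) + 3) * K)
    [:: Imp (And (color_atom X j) (color_atom Y j)) clash].
Proof.
move=> kX kY dXY hXY hclash; have [hX hY] := small_And hXY.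
have refl := provable_refl Hyp m_gt0 simF hXY.
have bot := provable_bot Hyp m_gt0 simF hclash.
have le4 : 4 * K <= (q + size (disjoint_pairs n k) + 3) * K.
  by apply: leq_mul => //; lia.
move: kX kY hX hY hXY refl; rewrite /color_atom /ksubset_or_empty.
case: (X =P set0) => [_ _ _ hX hY hXY refl|_].
  have p := provable_and_eliml m_gt0 simF hXY hX hY refl.
  by apply: provable_le (provable_trans m_gt0 simF hXY hX hclash p bot); lia.
case: (Y =P set0) => [_ _ _ hX hY hXY refl|_].
  have p := provable_and_elimr m_gt0 simF hXY hX hY refl.
  by apply: provable_le (provable_trans m_gt0 simF hXY hY hclash p bot); lia.
rewrite !orbF => kX kY _ _ hXY _.
have XY_in : (X, Y) \in disjoint_pairs n k.
  by rewrite mem_filter dXY allpairs_f ?mem_ksubsets.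
have clash_in := map_f clash_disj XY_in.
have hXYd := small_bigor_mem m_gt0 hclash clash_in.
have p1 := provable_bigor_intro Hyp m_gt0 simF hclash clash_in.
have p2 : provable (q * K) [:: Imp (And (Var (X, inord (j - 2 * k)))
    (Var (Y, inord (j - 2 * k)))) (clash_disj (X, Y))].
  have sz : size [seq And (Var ((X, Y).1, i)) (Var ((X, Y).2, i))
                 | i <- enum 'I_q] = q by rewrite size_map size_enum_ord.
  rewrite -[X in provable (X * K)]sz.
  apply: provable_bigor_intro => //.
  by apply/mapP; exists (inord (j - 2 * k)); rewrite ?mem_enum.
apply: provable_le (provable_trans m_gt0 simF hXY hXYd hclash p2 p1).
by rewrite size_map; lia.
Qed.

(** A positive label j pairs the first component of the smaller pair with the
    second component of the larger one, and a negative label does the reverse.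
    Both intersections are empty by the definition of comparability. *)
Lemma provable_complementary : small complementary_edge -> small clash ->
  provable (size (comparable_pairs n k) * size (labels n k) *
      ((q + size (disjoint_pairs n k) + 3) * K + K) + K)
    [:: Imp complementary_edge clash].
Proof.
move=> hedge hclash; rewrite -(size_allpairs (fun PQ i =>
   And (tucker_coloring (PQ.1.1, PQ.1.2, i))
       (tucker_coloring (PQ.2.1, PQ.2.2, - i)%R))).
apply: provable_bigor_elim => // phi phi_in.
have := small_bigor_mem m_gt0 hedge phi_in.
case/allpairsP: phi_in => -[[P Q] i] /= [].
rewrite mem_filter => /andP[/and5P[_ _ _ PQ /andP[QP _]]].
case/allpairsP=> -[P' Q'] /= [P_in Q_in [eP eQ]]; subst P' Q'.
move: P_in Q_in; rewrite !mem_tucker_pairs.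
move=> /and4P[kP1 kP2 _ _] /and4P[kQ1 kQ2 _ _].
case/mem_labels=> j /andP[le_j _].
have j_gt0 : 0 < j by apply: leq_trans le_j; rewrite muln_gt0 k_gt0.
case=> -> ->; rewrite tucker_coloring_opp ?GRing.opprK //= => hphi.
- exact: provable_clash.
- by apply: provable_clash; rewrite // setIC.
Qed.

(** colored_all implies each color_disj X, hence each antipodal_disj P, hence
    antipodal_all; the Tucker instance leads on to complementary_edge and clash.
    The cubic term comes from deriving at most L conjuncts, each by a case
    distinction over at most L colors, each case introducing a disjunction with
    at most L members. *)
Lemma provable_kneser L : 0 < K ->
  q <= L -> size (labels n k) <= L -> size (ksubsets n k) <= L ->
  size (tucker_pairs n k) <= L -> size (disjoint_pairs n k) <= L ->
  size (comparable_pairs n k) * size (labels n k) <= L ->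
  small colored_all -> small clash -> small antipodal_all ->
  small complementary_edge ->
  provable 1 [:: Imp antipodal_all complementary_edge] ->
  provable (23 * K * L ^ 3) [:: kneser n k].
Proof.
move=> K_gt0 Lq Llab Lsub Lpairs Ldisj Lcomp hcol hclash hant hedge tucker.
have L_gt0 : 0 < L by apply: leq_trans Lq.
(* With these the remaining bounds are linear in the monomials in K and L. *)
have le1 : K <= K * L by rewrite leq_pmulr.
have le2 : K * L <= K * L * L by rewrite leq_pmulr.
have le3 : K * L * L <= K * L * L * L by rewrite leq_pmulr.
have to_ant : provable (12 * K * L ^ 3) [:: Imp colored_all antipodal_all].
  suff p : {in [seq antipodal_disj P | P <- tucker_pairs n k], forall phi,
      provable (10 * K * L ^ 2) [:: Imp colored_all phi]}.
    apply: provable_le (provable_bigand_intro m_gt0 simF hcol hant p).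
    have h : size (tucker_pairs n k) * (10 * K * L ^ 2 + K) <=
             L * (10 * K * L ^ 2 + K) by rewrite leq_mul2r Lpairs orbT.
    by rewrite size_map; move: h le1 le2 le3; rewrite !expnS expn0; clear; lia.
  move=> _ /mapP[P P_in ->].
  have hP := small_bigand_mem m_gt0 hant (map_f antipodal_disj P_in).
  have [X [X_in pX]] := provable_antipodal P_in hP.
  have X_in' := map_f color_disj X_in.
  have hX := small_bigand_mem m_gt0 hcol X_in'.
  have p1 := provable_bigand_elim m_gt0 simF hcol hcol X_in'
    (provable_refl Hyp m_gt0 simF hcol).
  apply: provable_le (provable_trans m_gt0 simF hcol hX hP p1 (pX hX)).
  rewrite size_map !expnS expn0.
  have h1 : size (ksubsets n k) * K <= L * K by rewrite leq_mul2r Lsub orbT.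
  have h2 : q * (3 * K + size (labels n k) * K + K + K) <=
            L * (3 * K + L * K + K + K).
    by rewrite leq_mul // !leq_add2r leq_add2l leq_mul2r Llab orbT.
  by move: h1 h2 le1 le2; clear; lia.
have to_clash : provable (8 * K * L ^ 2) [:: Imp complementary_edge clash].
  apply: provable_le (provable_complementary hedge hclash).
  have h : size (comparable_pairs n k) * size (labels n k) *
      ((q + size (disjoint_pairs n k) + 3) * K + K) <=
      L * ((L + L + 3) * K + K).
    by rewrite leq_mul // leq_add2r leq_mul2r leq_add2r leq_add ?orbT.
  by rewrite !expnS expn0; move: h le1 le2; clear; lia.
rewrite kneserE.
apply: provable_le (provable_trans m_gt0 simF hcol hedge hclash
  (provable_trans m_gt0 simF hcol hant hedge to_ant tucker) to_clash).
by rewrite !expnS expn0; move: K_gt0 le1 le2 le3; clear; lia.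
Qed.

End Steps.
End KneserFromTucker.

(** * Polynomial bounds *)

Lemma bin_le_exp n k : 'C(n, k) <= n ^ k.
Proof.
apply: (@leq_trans (n ^_ k)).
  by rewrite -bin_ffact leq_pmulr ?fact_gt0.
elim: k n => [|k IH] [|n] //; rewrite ffactnS expnS leq_mul //=.
by apply: leq_trans (IH n) _; case: k {IH} => // k; rewrite leq_exp2r.
Qed.

Lemma size_ksubsets n k : size (ksubsets n k) = 'C(n, k).
Proof.
rewrite -[n in RHS]card_ord -(card_draws 'I_n) cardE; apply: perm_size.
apply: uniq_perm => [||X]; [exact/filter_uniq/enum_uniq|exact: enum_uniq|].
by rewrite mem_ksubsets mem_enum inE.
Qed.

Lemma size_tucker_pairs n k : size (tucker_pairs n k) <= ('C(n, k)).+1 ^ 2.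
Proof.
pose s := set0 :: ksubsets n k.
apply: (@leq_trans (size [seq (A, B) | A <- s, B <- s])); last first.
  by rewrite size_allpairs /= size_ksubsets -mulnn.
apply: uniq_leq_size; first exact/filter_uniq/enum_uniq.
move=> [A B]; rewrite mem_tucker_pairs /ksubset_or_empty => /and4P[kA kB _ _].
apply/allpairsP; exists (A, B).
by rewrite /s !inE !mem_ksubsets /= ![_ || (#|_| == k)]orbC.
Qed.

Lemma size_labels n k : 2 * k <= n -> size (labels n k) = 2 * (n - 2 * k).+1.
Proof.
by move=> h; rewrite size_cat !size_map !size_iota subSn // [RHS]mul2n addnn.
Qed.

(** The exponent is dictated by the members of Comp: there are at most n^(k+1)
    sets that are empty or of size k, four of them in a comparable pair, and at
    most n^2 labels. *)
Lemma list_sizes n k : 0 < k -> 2 * k <= n ->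
  [/\ (n - 2 * k).+1 <= n ^ (4 * k + 6),
      size (labels n k) <= n ^ (4 * k + 6),
      size (ksubsets n k) <= n ^ (4 * k + 6) &
   [/\ size (tucker_pairs n k) <= n ^ (4 * k + 6),
      size (disjoint_pairs n k) <= n ^ (4 * k + 6) &
      size (comparable_pairs n k) * size (labels n k) <= n ^ (4 * k + 6)]].
Proof.
move=> k_gt0 le_2k_n.
have n_gt1 : 1 < n by lia.
have n_gt0 := ltnW n_gt1.
have to_exp e1 x e : x <= n ^ e1 -> e1 <= e -> x <= n ^ e.
  by move=> h1 h2; apply: leq_trans h1 _; rewrite leq_pexp2l.
have binS : ('C(n, k)).+1 <= n ^ k.+1.
  apply: (@leq_trans (2 * n ^ k)); last by rewrite expnS leq_mul2r n_gt1 orbT.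
  by rewrite mul2n -addnn -addn1 leq_add ?bin_le_exp ?expn_gt0 ?n_gt0.
have tucker : size (tucker_pairs n k) <= n ^ (k.+1 * 2).
  by apply: leq_trans (size_tucker_pairs _ _) _; rewrite expnM leq_exp2r.
have labs : size (labels n k) <= n ^ 2.
  by rewrite size_labels // -mulnn leq_mul //; lia.
have sub : size (ksubsets n k) <= n ^ k by rewrite size_ksubsets bin_le_exp.
split; first by apply: (to_exp 1); rewrite ?expn1; lia.
- by apply: to_exp labs _; lia.
- by apply: to_exp sub _; lia.
split; first by apply: to_exp tucker _; lia.
- apply: (to_exp (k + k)); last by lia.
  rewrite expnD; apply: leq_trans (leq_mul sub sub).
  by rewrite -(size_allpairs pair) size_filter count_size.
apply: (to_exp (k.+1 * 2 + k.+1 * 2 + 2)); last by lia.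
rewrite expnD leq_mul // expnD; apply: leq_trans (leq_mul tucker tucker).
by rewrite -(size_allpairs pair) size_filter count_size.
Qed.

(** The innermost disjuncts are variables, constants or conjunctions of two of
    these. *)
Definition tiny (V : Type) (phi : form V) : bool :=
  (fsize phi <= 3) && (depth phi <= 1).

Lemma small_flat (V : eqType) L (s : seq (form V)) : 0 < L -> size s <= L ->
  all (@tiny V) s -> small (7 * L ^ 2) 3 (bigor s).
Proof.
move=> L_gt0 le_s tiny_s; apply/andP; split.
  have fs : all (fun phi => fsize phi <= 3) s.
    by apply: sub_all tiny_s => phi /andP[].
  have := fsize_bigor fs; rewrite -mulnn; move: L_gt0 le_s; clear; nia.
apply: leq_trans (_ : _ <= 2) _ => //; apply: depth_bigor.
by apply: sub_all tiny_s => phi /andP[].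
Qed.

(** A list of at most L tiny formulas has a disjunction of size at most 4L + 1,
    so at most L such disjunctions combine to size L(4L + 2) + 1 <= 7L^2. *)
Lemma small_nested (V I : eqType) L (s : seq I) (g : I -> seq (form V)) :
  0 < L -> size s <= L ->
  (forall i, i \in s -> size (g i) <= L /\ all (@tiny V) (g i)) ->
  small (7 * L ^ 2) 3 (bigand [seq bigor (g i) | i <- s]) /\
  small (7 * L ^ 2) 3 (bigor [seq bigor (g i) | i <- s]).
Proof.
move=> L_gt0 le_s hg.
have fs : all (fun phi => fsize phi <= L * 4 + 1) [seq bigor (g i) | i <- s].
  rewrite all_map; apply/allP => i /hg[le_g tiny_g] /=.
  apply: leq_trans (fsize_bigor (f := 3) _) _.
    by apply: sub_all tiny_g => phi /andP[].
  by rewrite leq_add2r leq_mul2r le_g orbT.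
have ds : all (fun phi => depth phi <= 2) [seq bigor (g i) | i <- s].
  rewrite all_map; apply/allP => i /hg[le_g tiny_g] /=.
  by apply: depth_bigor; apply: sub_all tiny_g => phi /andP[].
have le_m : size [seq bigor (g i) | i <- s] * (L * 4 + 1).+1 + 1 <= 7 * L ^ 2.
  rewrite size_map -mulnn.
  have h : size s * (L * 4 + 1).+1 <= L * (L * 4 + 1).+1.
    by rewrite leq_mul2r le_s orbT.
  have h1 : L <= L * L by rewrite leq_pmulr.
  by move: h h1 L_gt0; clear; lia.
split; apply/andP; split; try by [apply: depth_bigand|apply: depth_bigor].
  exact: leq_trans (fsize_bigand fs) le_m.
exact: leq_trans (fsize_bigor fs) le_m.
Qed.

Lemma tiny_tucker_pair n k (p q : tvar n) :
  tiny (And (tucker_coloring k p) (tucker_coloring k q)).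
Proof.
case: p q => [P [i|i]] [Q [j|j]];
  by rewrite /tucker_coloring /color_atom /=; do 2!case: ifP.
Qed.

Section Smallness.
Variables n k L : nat.
Hypotheses (L_gt0 : 0 < L) (Lq : (n - 2 * k).+1 <= L).
Hypothesis Llab : size (labels n k) <= L.

Lemma small_colored_all :
  size (ksubsets n k) <= L -> small (7 * L ^ 2) 3 (colored_all n k).
Proof.
move=> Lsub.
pose g X := [seq @Var (kvar n k) (X, i) | i <- enum 'I_(n - 2 * k).+1].
have [] // := @small_nested _ _ L (ksubsets n k) g L_gt0 Lsub.
move=> X _; rewrite size_map size_enum_ord; split=> //.
by rewrite all_map; apply/allP.
Qed.

Lemma small_clash :
  size (disjoint_pairs n k) <= L -> small (7 * L ^ 2) 3 (clash n k).
Proof.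
move=> Ldisj; pose g XY := [seq And (@Var (kvar n k) (XY.1, i)) (Var (XY.2, i))
                           | i <- enum 'I_(n - 2 * k).+1].
have [] // := @small_nested _ _ L (disjoint_pairs n k) g L_gt0 Ldisj.
move=> XY _; rewrite size_map size_enum_ord; split=> //.
by rewrite all_map; apply/allP.
Qed.

Lemma small_antipodal_all :
  size (tucker_pairs n k) <= L -> small (7 * L ^ 2) 3 (antipodal_all n k).
Proof.
move=> Lpairs.
pose g (P : {set 'I_n} * {set 'I_n}) := [seq And
  (tucker_coloring k (P.1, P.2, i))
  (tucker_coloring k (P.2, P.1, - i)%R) | i <- labels n k].
have [] // := @small_nested _ _ L (tucker_pairs n k) g L_gt0 Lpairs.
move=> P _; rewrite size_map; split=> //.
by rewrite all_map; apply/allP=> i _; apply: tiny_tucker_pair.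
Qed.

Lemma small_complementary_edge :
  size (comparable_pairs n k) * size (labels n k) <= L ->
  small (7 * L ^ 2) 3 (complementary_edge n k).
Proof.
move=> Lcomp; apply: small_flat => //; first by rewrite size_allpairs.
by apply/allP=> _ /allpairsP[[PQ i] [_ _ ->]]; apply: tiny_tucker_pair.
Qed.

End Smallness.

Theorem mainTheorem4 (F : seq rule) (hF : frege_system F)
    (k : nat) (hk : 1 <= k) :
  exists c d : nat, forall n : nat, 2 * k <= n ->
    exists pi : seq (form (kvar n k)),
      [/\ is_proof F (@tucker_instance (kvar n k) n k) pi (kneser n k),
          proof_size pi <= n ^ c + c &
          proof_depth_le d pi].
Proof.
have [K0 sim0] := simulates_all (proj2 hF) basic_rules_entail.
pose K := K0 + 3.
have simF : {in basic_rules, forall r, simulates F K r}.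
  by move=> r /sim0; apply: simulates_mono; rewrite leq_addr.
have K_ge3 : 3 <= K by rewrite leq_addl.
exists (161 * K ^ 2 + (4 * k + 6) * 5), (K + 3) => n le_2k_n.
have [Lq Llab Lsub [Lpairs Ldisj Lcomp]] := list_sizes hk le_2k_n.
set L := n ^ (4 * k + 6) in Lq Llab Lsub Lpairs Ldisj Lcomp.
have n_gt1 : 1 < n by lia.
have L_gt0 : 0 < L by apply: leq_trans Lq.
have m_gt0 : 0 < 7 * L ^ 2 by rewrite muln_gt0 expn_gt0 L_gt0.
have hcol := small_colored_all L_gt0 Lq Lsub.
have hclash := small_clash L_gt0 Lq Ldisj.
have hant := small_antipodal_all L_gt0 Llab Lpairs.
have hedge := small_complementary_edge L_gt0 Lcomp.
(* The only line that is not derived by a rule of F. *)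
have tucker : provable F (@tucker_instance (kvar n k) n k) K (7 * L ^ 2) 3 1
    [:: Imp (antipodal_all n k) (complementary_edge n k)].
  apply: provable_hyp.
    by exists (@tucker_coloring n k); rewrite subst_truncated_tucker.
  case/andP: hant hedge => [fa da] /andP[fe de]; apply/andP; split.
    apply: (@leq_trans (3 * (7 * L ^ 2))); last by rewrite leq_mul2r K_ge3 orbT.
    apply: (@leq_trans (7 * L ^ 2 + 7 * L ^ 2).+1).
      by rewrite [fsize (Imp _ _)]/= ltnS leq_add.
    by move: m_gt0; clear; lia.
  apply: (@leq_trans 4); first by rewrite [depth (Imp _ _)]/= ltnS geq_max da.
  by move: K_ge3; clear; lia.
have [pi [proof sz dp]] := provable_is_proof (provable_kneser hk le_2k_n m_gt0 simF
  (leq_trans (isT : 0 < 3) K_ge3) Lq Llab Lsub Lpairs Ldisj Lcomp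
  hcol hclash hant hedge tucker).
exists pi; split=> //; apply: leq_trans sz _; apply: leq_trans (leq_addr _ _).
(* Number of lines times maximal size of a line. *)
have -> : 23 * K * L ^ 3 * (K * (7 * L ^ 2)) = 161 * K ^ 2 * L ^ 5.
  by rewrite !expnS expn0; clear; lia.
(* The constant factor goes into the exponent because n is at least 2. *)
rewrite expnD leq_mul //; last by rewrite /L -expnM.
exact: ltnW (ltn_expl _ n_gt1).
Qed.
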